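(* If $H_1$ and $H_2$ are shortest path graphs, then the disjoint union $H_1\cup H_2$ is a shortest path graph.
   Context: Graphs are finite and simple. For a graph $G$ with distinct vertices $a,b$, a shortest $a,b$-path is a path between $a$ and $b$ of length $d_G(a,b)$. The shortest path graph $S(G,a,b)$ is the graph whose vertices are the shortest $a,b$-paths in $G$, two of them being adjacent if and only if the corresponding paths differ in exactly one vertex. A graph $H$ is called a shortest path graph if there exist a graph $G$ and distinct $a,b\in V(G)$ with $S(G,a,b)\cong H$. The disjoint union of $H_1$ and $H_2$ (taken with disjoint vertex sets) has vertex set $V(H_1)\cup V(H_2)$ and edge set $E(H_1)\cup E(H_2)$. *)

(* Defs.v *)
From HB Require Import structures.
From mathcomp Require Import all_boot.

Set Implicit Arguments.
Unset Strict Implicit.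
Unset Printing Implicit Defensive.

Record sgraph := SGraph {
  vertex :> finType;
  adj : rel vertex;
  adj_sym : symmetric adj;
  adj_irrefl : irreflexive adj }.

Definition isomorphic (G H : sgraph) : Prop :=
  exists2 f : G -> H, bijective f & forall x y, adj (f x) (f y) = adj x y.

(* The path is the vertex sequence a :: p, so its length is size p. *)
Definition gpath (G : sgraph) (a b : G) (p : seq G) : bool :=
  [&& path (@adj G) a p, last a p == b & uniq (a :: p)].

(* The least length of an a,b-path.  If there is no a,b-path the value is #|G|,
   which stands for infinity, since every path has length < #|G|. *)
Definition dist (G : sgraph) (a b : G) : nat :=
  find (fun n => [exists p : n.-tuple G, gpath a b p]) (iota 0 #|G|).

(* As a != b in all uses, each a,b-path corresponds to a single sequence
   starting at a. *)
Definition shortest_path (G : sgraph) (a b : G) : finType :=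
  {p : (dist a b).-tuple G | gpath a b p}.

(* The paths share their first vertex a and have equal length, so they are
   compared position by position; in a shortest path the position of a vertex
   is its distance from a. *)
Definition sp_adj (G : sgraph) (a b : G) : rel (shortest_path a b) :=
  fun P Q => #|[set i | tnth (val P) i != tnth (val Q) i]| == 1.

Lemma sp_adj_sym (G : sgraph) (a b : G) : symmetric (@sp_adj G a b).
Proof.
move=> P Q; rewrite /sp_adj; congr (_ == _); apply: eq_card => i.
by rewrite !inE eq_sym.
Qed.

Lemma sp_adj_irrefl (G : sgraph) (a b : G) : irreflexive (@sp_adj G a b).
Proof.
by move=> P; rewrite /sp_adj eq_card0 // => i; rewrite !inE eqxx.
Qed.

Definition sp_graph (G : sgraph) (a b : G) : sgraph :=
  SGraph (@sp_adj_sym G a b) (@sp_adj_irrefl G a b).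

Definition is_shortest_path_graph (H : sgraph) : Prop :=
  exists (G : sgraph) (a b : G), a != b /\ isomorphic (sp_graph a b) H.

Definition dunion_adj (G H : sgraph) : rel (G + H)%type :=
  fun u v => match u, v with
             | inl x, inl y => adj x y
             | inr x, inr y => adj x y
             | _, _ => false
             end.

Lemma dunion_adj_sym (G H : sgraph) : symmetric (@dunion_adj G H).
Proof. by move=> [x|x] [y|y] //=; apply: adj_sym. Qed.

Lemma dunion_adj_irrefl (G H : sgraph) : irreflexive (@dunion_adj G H).
Proof. by move=> [x|x] /=; apply: adj_irrefl. Qed.

Definition disjoint_union (G H : sgraph) : sgraph :=
  SGraph (@dunion_adj_sym G H) (@dunion_adj_irrefl G H).

(* Main.v *)
Require Import Defs.
From mathcomp Require Import all_boot.

(** Pad the two families of shortest paths to a common length by waiting at the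
    end vertex, then join them in parallel between a new source and a new sink.
    Time-dependent walks of length [n] are the shortest paths of the graph whose
    vertices are pairs (state, time): each edge changes the time by one, so a
    path of length [n] from time 0 to time [n] is forced to be increasing in
    time.  Paths from different families differ at every interior vertex, and
    there are at least two of these, so they are never adjacent.  An empty union
    is treated apart, since the layered graph could then have longer zigzag paths
    from source to sink. *)

Set Implicit Arguments.
Unset Strict Implicit.
Unset Printing Implicit Defensive.

(** * Hamming distance between sequences *)

Section Hamming.
Variables T U : eqType.
Implicit Types (p q : seq T) (f : T -> U).

(** [zip] truncates at the shorter sequence, so this is the Hamming distance only for sequences of
    equal length. *)
Definition hamming (S : eqType) (p q : seq S) : nat :=
  count (fun u => u.1 != u.2) (zip p q).

Lemma hamming_catr p q s : size p = size q ->
  hamming (p ++ s) (q ++ s) = hamming p q.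
Proof.
move=> eq_pq; rewrite /hamming zip_cat // count_cat.
suff -> : count (fun u => u.1 != u.2) (zip s s) = 0 by rewrite addn0.
by elim: s => //= x s ->; rewrite eqxx.
Qed.

Lemma hamming_map f p q : injective f ->
  hamming (map f p) (map f q) = hamming p q.
Proof.
move=> f_inj; elim: p q => [|x p IHp] [|y q] //=.
by rewrite /hamming /= inj_eq //; congr (_ + _); apply: IHp.
Qed.

Lemma hammingC p q : hamming p q = hamming q p.
Proof.
elim: p q => [|x p IHp] [|y q] //.
by rewrite /hamming /= eq_sym; congr (_ + _); apply: IHp.
Qed.

End Hamming.

Lemma hamming_inl_inr (T U : eqType) (p : seq T) (q : seq U) :
  size p = size q ->
  hamming [seq inl x | x <- p] [seq inr y | y <- q] = size p.
Proof.
elim: p q => [|x p IHp] [|y q] //= [eq_pq].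
by rewrite /hamming /= add1n; congr _.+1; apply: IHp.
Qed.

(** Bridge from the index count in [sp_adj] to plain sequences: both sides count over the
    enumeration of ['I_n]. *)
Lemma card_tnth_neq (T : eqType) n (p q : n.-tuple T) :
  #|[set i | tnth p i != tnth q i]| = hamming p q.
Proof.
rewrite /hamming -(map_tnth_enum p) -(map_tnth_enum q) zip_map count_map.
by rewrite cardsE cardE enumT /enum_mem size_filter; apply: eq_count.
Qed.

(** * Distance and shortest paths in terms of walks *)

Section Distance.
Variables (G : sgraph) (a b : G).

(** Cutting out cycles turns the walk into a path of length below [#|G|], so the search in [dist]
    succeeds and does not return its default. *)
Lemma dist_walk (p : seq G) : path (@adj G) a p -> last a p = b ->
  dist a b <= size p /\ exists2 q, gpath a b q & size q = dist a b.
Proof.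
move=> ap lp.
have [q [gq le_qp]] : exists q, gpath a b q /\ size q <= size p.
  move: lp; case/shortenP: ap => q aq uq sub lq.
  exists q; split; first by rewrite /gpath aq lq eqxx uq.
  by apply: uniq_leq_size sub; case/andP: uq.
have lt_q : size q < #|G|.
  case/and3P: gq => _ _ uq.
  by have := max_card (mem (a :: q)); rewrite (card_uniqP uq).
pose P n := [exists q : n.-tuple G, gpath a b q].
have Pq : P (size q) by apply/existsP; exists (in_tuple q).
have hasP : has P (iota 0 #|G|).
  by apply/hasP; exists (size q); rewrite ?mem_iota.
have le_dist : dist a b <= size q.
  rewrite leqNgt; apply/negP => /(before_find 0).
  by rewrite nth_iota // add0n -/(P _) Pq.
split; first exact: leq_trans le_qp.
have := nth_find 0 hasP; rewrite nth_iota; last by rewrite -{2}(size_iota 0 #|G|) -has_find.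
by rewrite add0n => /existsP [t gt]; exists t; rewrite ?size_tuple.
Qed.

(** Minimality makes repetition impossible: the cycle-free walk extracted from [p] is no shorter
    than [dist a b], so it has as many vertices as [p] and [p] is already duplicate-free. *)
Lemma gpath_dist (p : seq G) : size p = dist a b ->
  gpath a b p = path (@adj G) a p && (last a p == b).
Proof.
move=> sp; rewrite /gpath; case ap: path => //; case: eqP => // lp.
suff -> : uniq (a :: p) by [].
move: (ap) (lp); case/shortenP=> q aq uq sub lq.
have [le_dist _] := dist_walk aq lq.
apply: (leq_size_uniq uq) => [x|]; last by rewrite /= sp ltnS.
by rewrite !inE => /orP [->|/sub ->] //; rewrite orbT.
Qed.

End Distance.

(** * Walks whose step relation depends on time *)

Section TimedWalks.
Variable T : eqType.
Implicit Types (r : nat -> rel T) (q : seq T).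

Fixpoint tpath r i x q : bool :=
  if q is y :: q' then r i x y && tpath r i.+1 y q' else true.

Definition twalk r s t n q : bool :=
  [&& size q == n, tpath r 0 s q & last s q == t].

Lemma tpath_cat r i x q1 q2 :
  tpath r i x (q1 ++ q2) =
  tpath r i x q1 && tpath r (i + size q1) (last x q1) q2.
Proof.
elim: q1 i x => [|y q IHq] i x /=; first by rewrite addn0.
by rewrite IHq andbA addSnnS.
Qed.

Lemma eq_tpath_path r (e : rel T) i x q :
  (forall j, i <= j < i + size q -> r j =2 e) -> tpath r i x q = path e x q.
Proof.
elim: q i x => //= y q IHq i x re.
rewrite re; last by rewrite leqnn -addSnnS leq_addr.
by rewrite IHq // => j /andP [lt_ij ltj]; apply: re; rewrite ltnW // -addSnnS.
Qed.

End TimedWalks.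

(** * Graphs encoded as sets of sequences *)

(** [f] labels the vertices bijectively by the sequences in [W], with Hamming distance one as
    adjacency. Thus [W] alone fixes [H] up to isomorphism, and constructions can be carried out on
    sequences. *)
Definition represented (H : sgraph) (T : eqType) (W : pred (seq T)) : Prop :=
  exists f : H -> seq T,
    [/\ injective f, forall q, (exists x, f x = q) <-> W q
      & forall x y, adj x y = (hamming (f x) (f y) == 1)].

Lemma represented_iso (H K : sgraph) (T : eqType) (W : pred (seq T)) :
  represented H W -> represented K W -> isomorphic H K.
Proof.
move=> [f [f_inj fW f_adj]] [g [g_inj gW g_adj]].
(* Vertices with the same sequence are matched; the boolean [==] lets [xchoose] turn mere existence
   into a function. *)
have fg x : exists y, g y == f x.
  by have /gW [y <-] : W (f x) by [apply/fW; exists x]; exists y.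
have gf y : exists x, f x == g y.
  by have /fW [x <-] : W (g y) by [apply/gW; exists y]; exists x.
have fgK x : g (xchoose (fg x)) = f x by apply/eqP/(xchooseP (fg x)).
have gfK y : f (xchoose (gf y)) = g y by apply/eqP/(xchooseP (gf y)).
exists (fun x => xchoose (fg x)) => [|x y]; last by rewrite g_adj f_adj !fgK.
exists (fun y => xchoose (gf y)) => x; first by apply: f_inj; rewrite gfK fgK.
by apply: g_inj; rewrite fgK gfK.
Qed.

Lemma iso_represented (H K : sgraph) (T : eqType) (W : pred (seq T)) :
  isomorphic H K -> represented H W -> represented K W.
Proof.
move=> [h [k hK kH] h_adj] [f [f_inj fW f_adj]].
exists (f \o k); split=> [x y /f_inj /(can_inj kH) //|q|x y] /=.
  split=> [[y <-]|/fW [x <-]]; first by apply/fW; exists (k y).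
  by exists (h x); rewrite hK.
by rewrite -f_adj -h_adj !kH.
Qed.

Lemma sp_graph_represented (G : sgraph) (a b : G) :
  represented (sp_graph a b) (twalk (fun=> @adj G) a b (dist a b)).
Proof.
exists (fun P => val (val P)); split=> [P Q /val_inj /val_inj //|q|P Q].
  apply: rwP; apply: (iffP and3P) => [[/eqP sq wq lq]|[P <-]].
    have gq : gpath a b q.
      by rewrite gpath_dist // lq andbT -(@eq_tpath_path _ (fun=> @adj G) _ 0).
    have eq_sq : size q == dist a b by rewrite sq.
    by exists (exist (fun p : (dist a b).-tuple G => gpath a b p) (Tuple eq_sq) gq).
  have := valP P; rewrite gpath_dist ?size_tuple // => /andP [pP ->].
  by rewrite (@eq_tpath_path _ _ (@adj G)) ?eqxx.
by rewrite /adj /= /sp_adj card_tnth_neq.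
Qed.

(** * The layered graph and its shortest paths *)

Section Layers.
Variables (T : finType) (r : nat -> rel T) (n : nat).

Definition layer_adj : rel (T * 'I_n.+1) := fun u v =>
  (u.2.+1 == v.2) && r u.2 u.1 v.1 || (v.2.+1 == u.2) && r v.2 v.1 u.1.

Lemma layer_adj_sym : symmetric layer_adj.
Proof. by move=> u v; rewrite /layer_adj orbC. Qed.

Lemma layer_adj_irrefl : irreflexive layer_adj.
Proof. by move=> u; rewrite /layer_adj eqn_leq ltnn. Qed.

Definition layer_graph : sgraph := SGraph layer_adj_sym layer_adj_irrefl.

(** Times live in ['I_n.+1], so [inord i] is the intended time only while [i <= n]; beyond that it
    is a default value. *)
Fixpoint timestamp i (q : seq T) : seq layer_graph :=
  if q is x :: q' then (x, inord i) :: timestamp i.+1 q' else [::].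

Lemma size_timestamp i q : size (timestamp i q) = size q.
Proof. by elim: q i => //= x q IHq i; rewrite IHq. Qed.

Lemma timestampK i : cancel (timestamp i) (map fst).
Proof. by move=> q; elim: q i => //= x q IHq i; rewrite IHq. Qed.

Lemma hamming_timestamp i p q :
  hamming (timestamp i p) (timestamp i q) = hamming p q.
Proof.
elim: p q i => [|x p IHp] [|y q] i //; rewrite /hamming /= xpair_eqE eqxx andbT.
by congr (_ + _); apply: IHp.
Qed.

Lemma timestamp_path i x q : i + size q <= n -> tpath r i x q ->
  path (@adj layer_graph) (x, inord i) (timestamp i.+1 q) /\
  last (x, inord i) (timestamp i.+1 q) = (last x q, inord (i + size q)).
Proof.
elim: q i x => [|y q IHq] i x /=; first by rewrite addn0.
rewrite -addSnnS => le_n /andP [rxy /IHq [//|-> ->]]; split=> //.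
have lt_in : i < n by rewrite (leq_trans _ le_n) // leq_addr.
by rewrite /layer_adj /= !inordK ?ltnS ?(ltnW lt_in) // eqxx rxy.
Qed.

Lemma layer_path_height (u : layer_graph) p :
  path (@adj layer_graph) u p -> (last u p).2 <= u.2 + size p.
Proof.
elim: p u => [|v p IHp] u /=; first by rewrite addn0.
case/andP=> uv /IHp /leq_trans -> //; rewrite -addSnnS leq_add2r.
by case/orP: uv => /andP [/eqP <- _] //; apply: leqW.
Qed.

Lemma layer_path_timestamp (u : layer_graph) p :
    path (@adj layer_graph) u p -> (last u p).2 = u.2 + size p :> nat ->
  tpath r u.2 u.1 (map fst p) /\ p = timestamp u.2.+1 (map fst p).
Proof.
elim: p u => //= v p IHp u /andP [uv vp] lastE.
(* The edges after [v] gain at most [size p], so the first edge has to move forward. *)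
have le_h := layer_path_height vp.
have lt_uv : u.2 < v.2 by move: le_h; rewrite lastE -addSnnS leq_add2r.
case/orP: uv => /andP [/eqP eq_uv ruv]; last first.
  by move: lt_uv; rewrite -eq_uv ltnNge leqnSn.
have [|wp ->] := IHp v vp; first by rewrite lastE -eq_uv addSnnS.
rewrite timestampK eq_uv inord_val ruv wp.
by split=> //; case: (v).
Qed.

Variables s t : T.
Let s0 : layer_graph := (s, ord0).
Let tn : layer_graph := (t, ord_max).

Lemma layer_twalk_path q : twalk r s t n q ->
  path (@adj layer_graph) s0 (timestamp 1 q) /\ last s0 (timestamp 1 q) = tn.
Proof.
case/and3P=> /eqP sq wq /eqP lq.
have inord0 : inord 0 = ord0 :> 'I_n.+1 by apply: val_inj; rewrite /= inordK.
have := @timestamp_path 0 s q; rewrite add0n sq leqnn inord0 lq => /(_ isT wq).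
case=> -> ->; split=> //; congr (_, _); apply: val_inj.
by rewrite /= inordK.
Qed.

(** The timestamped walk bounds the distance from above, the height bound from below. *)
Lemma dist_layer q : twalk r s t n q -> dist s0 tn = n.
Proof.
move=> wq; have [pq lq] := layer_twalk_path wq.
have [le_n [p /and3P [pp /eqP lp _] sp]] := dist_walk pq lq.
move: le_n; rewrite size_timestamp; case/and3P: wq => /eqP -> _ _ le_n.
apply/eqP; rewrite eqn_leq le_n -sp.
by have := layer_path_height pp; rewrite lp.
Qed.

Lemma represented_spg (H : sgraph) : 0 < n -> H ->
  represented H (twalk r s t n) -> is_shortest_path_graph H.
Proof.
move=> n_gt0 x0 [f [f_inj fW f_adj]].
have W0 : twalk r s t n (f x0) by apply/fW; exists x0.
exists layer_graph, s0, tn; split.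
  (* The endpoints are told apart by their times [0] and [n], since [s] and [t] may coincide. *)
  by apply: contraTneq n_gt0 => /(congr1 (fun u => val u.2)) /= <-.
apply: represented_iso (sp_graph_represented _ _) _.
exists (timestamp 1 \o f); split=> [x y /(can_inj (timestampK 1)) /f_inj //|p|x y].
  rewrite (dist_layer W0); apply: rwP; apply: (iffP and3P) => [[/eqP sp wp /eqP lp]|[x <-]].
    rewrite (@eq_tpath_path _ _ (@adj layer_graph)) // in wp.
    have [|wq pE] := layer_path_timestamp wp; first by rewrite lp sp.
    have /fW [x fx] : twalk r s t n (map fst p).
      by rewrite /twalk size_map sp eqxx wq -[s]/(s0.1) last_map lp /=.
    by exists x; rewrite /= fx -pE.
  have Wx : twalk r s t n (f x) by apply/fW; exists x.
  have [px lx] := layer_twalk_path Wx; case/and3P: Wx => sx _ _.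
  rewrite (@eq_tpath_path _ _ (@adj layer_graph)) // /= size_timestamp px lx.
  by rewrite sx eqxx.
by rewrite f_adj /= hamming_timestamp.
Qed.

End Layers.

(** Take two isolated vertices: the empty sequence does not reach the end vertex, and a nonempty one
    would need an edge. *)
Lemma empty_spg (H : sgraph) : #|H| = 0 -> is_shortest_path_graph H.
Proof.
move=> H0.
have sym0 : symmetric (fun _ _ : bool => false) by [].
have irr0 : irreflexive (fun _ _ : bool => false) by [].
pose G := SGraph sym0 irr0; exists G, (true : G), (false : G); split=> //.
have noP (P : sp_graph (true : G) (false : G)) : False.
  by case: P => p /and3P []; case: (tval p).
have noH (x : H) : False by have := fintype0 x H0.
exists (fun P => False_rect H (noP P)) => [|P]; last by case: (noP P).
by exists (fun x => False_rect _ (noH x)) => [P|x]; [case: (noP P)|case: (noH x)].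
Qed.

(** * Padding walks to a prescribed length *)

Section Padding.
Variables (T : eqType) (e : rel T) (a b : T) (d n : nat).

Definition padded i : rel T :=
  fun x y => if i < d then e x y else (x == b) && (y == b).

Lemma padded_nseq i x k : d <= i -> x = b ->
  tpath padded i x (nseq k b).
Proof.
move=> le_di ->; elim: k i le_di => //= k IHk i le_di.
by rewrite /padded ltnNge le_di /= eqxx IHk // leqW.
Qed.

Lemma padded_tail i x q : d <= i -> tpath padded i x q -> last x q = b ->
  x = b /\ q = nseq (size q) b.
Proof.
elim: q i x => //= y q IHq i x le_di; rewrite {1}/padded ltnNge le_di /=.
by case/andP=> /andP [/eqP -> _] wq /(IHq _ _ (leqW le_di) wq) [-> {1}->].
Qed.

(** From time [d] on only the loop at [b] is available, so the walk must already be at [b] then, and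
    its tail is constant. *)
Lemma twalk_padded q : d <= n ->
  reflect (exists2 p, twalk (fun=> e) a b d p & p ++ nseq (n - d) b = q)
          (twalk padded a b n q).
Proof.
have headE p : size p = d -> tpath padded 0 a p = tpath (fun=> e) 0 a p.
  move=> sp; rewrite (@eq_tpath_path _ _ e) ?(@eq_tpath_path _ (fun=> e) e) //.
  by move=> j; rewrite add0n sp => /andP [_ ltj] x y; rewrite /padded ltj.
move=> le_dn; apply: (iffP idP) => [|[p /and3P [/eqP sp wp /eqP lp] <-]].
  case/and3P=> /eqP sq; rewrite -{1 2}(cat_take_drop d q) tpath_cat last_cat.
  have st : size (take d q) = d by rewrite size_takel ?sq.
  case/andP=> wt wd /eqP ld; have [|lt dE] := padded_tail _ wd ld.
    by rewrite st.
  exists (take d q); first by rewrite /twalk st eqxx -headE // wt lt eqxx.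
  by rewrite -sq -size_drop -dE cat_take_drop.
rewrite /twalk size_cat size_nseq sp subnKC // eqxx tpath_cat headE // wp.
rewrite padded_nseq ?sp // last_cat lp /=.
by case: (n - d) => //= k; elim: k.
Qed.

Lemma represented_padded (H : sgraph) : d <= n ->
  represented H (twalk (fun=> e) a b d) -> represented H (twalk padded a b n).
Proof.
move=> le_dn [f [f_inj fW f_adj]].
have sf x : size (f x) = d.
  by have /and3P [/eqP] : twalk (fun=> e) a b d (f x) by apply/fW; exists x.
exists (fun x => f x ++ nseq (n - d) b); split=> [x y /eqP|q|x y].
- by rewrite eqseq_cat ?sf // => /andP [/eqP /f_inj].
- apply: rwP; apply: (iffP (twalk_padded q le_dn)) => [[p /fW [x <-]] <-|[x <-]].
    by exists x.
  by exists (f x) => //; apply/fW; exists x.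
- by rewrite f_adj hamming_catr ?sf.
Qed.

End Padding.

(** * Parallel composition of two families of walks *)

Section Sum.
Variables (T1 T2 : eqType) (r1 : nat -> rel T1) (r2 : nat -> rel T2).
Variables (a1 b1 : T1) (a2 b2 : T2) (n : nat).

(* The endpoints [inl b1] at times 0 and [n + 2] only serve as names for the
   common source and sink: the layer graph separates them from other times. *)
Definition sum_step i : rel (T1 + T2)%type := fun u v =>
  if i is j.+1 then
    if j == n then (u == inl b1) || (u == inr b2) else
    match u, v with
    | inl x, inl y => r1 j x y
    | inr x, inr y => r2 j x y
    | _, _ => false
    end
  else (v == inl a1) || (v == inr a2).

Let c1 : T1 -> T1 + T2 := inl.
Let c2 : T2 -> T1 + T2 := inr.

(** No step strictly between entry and exit changes the summand. The shift to [i.+1] accounts for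
    the entry step, and the bound by [n] stops before the exit step. *)
Lemma sum_tpath_inl i x q : i + size q <= n ->
  reflect (exists2 p, tpath r1 i x p & map c1 p = q)
          (tpath sum_step i.+1 (inl x) q).
Proof.
elim: q i x => [|v q IHq] i x /=; first by left; exists [::].
rewrite -addSnnS => le_n.
have lt_in : i < n by rewrite (leq_trans _ le_n) // leq_addr.
rewrite (ltn_eqF lt_in); case: v => y; last by right => -[[|z p]].
apply: (iffP andP) => [[rxy /(IHq _ _ le_n) [p wp <-]]|[[//|z p]]].
  by exists (y :: p); rewrite /= ?rxy.
by case/andP=> rxz wp [<- pE]; split=> //; apply/(IHq _ _ le_n); exists p.
Qed.

Lemma sum_tpath_inr i x q : i + size q <= n ->
  reflect (exists2 p, tpath r2 i x p & map c2 p = q)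
          (tpath sum_step i.+1 (inr x) q).
Proof.
elim: q i x => [|v q IHq] i x /=; first by left; exists [::].
rewrite -addSnnS => le_n.
have lt_in : i < n by rewrite (leq_trans _ le_n) // leq_addr.
rewrite (ltn_eqF lt_in); case: v => y; first by right => -[[|z p]].
apply: (iffP andP) => [[rxy /(IHq _ _ le_n) [p wp <-]]|[[//|z p]]].
  by exists (y :: p); rewrite /= ?rxy.
by case/andP=> rxz wp [<- pE]; split=> //; apply/(IHq _ _ le_n); exists p.
Qed.

Let ext1 p := rcons (map c1 (a1 :: p)) (c1 b1).
Let ext2 p := rcons (map c2 (a2 :: p)) (c1 b1).

Lemma twalk_sum q :
  reflect ((exists2 p, twalk r1 a1 b1 n p & ext1 p = q) \/
           (exists2 p, twalk r2 a2 b2 n p & ext2 p = q))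
          (twalk sum_step (c1 b1) (c1 b1) n.+2 q).
Proof.
apply: (iffP idP) => [|[] [p /and3P [/eqP sp wp /eqP lp] <-]].
(* Split off the entry vertex [v] and the sink [w]; the [n] steps between them stay in the summand
   selected by [v]. *)
- case/and3P; case: q => // v q; case: (lastP q) => // {}q w.
  rewrite /= size_rcons last_rcons -cats1 tpath_cat add1n /= => /eqP [sq].
  rewrite sq eqxx andbT => /and3P [v0 wq lq] /eqP ->.
  have le_n : 0 + size q <= n by rewrite sq.
  case/orP: v0 => /eqP vE; rewrite vE in wq lq *.
    case/(sum_tpath_inl _ le_n): wq => p wp qE; left; exists p.
      rewrite /twalk wp -(size_map c1) qE sq eqxx /=.
      by move: lq; rewrite -qE (last_map c1) => /orP [] /eqP [] // ->.
    by rewrite /ext1 /= -cats1 qE.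
  case/(sum_tpath_inr _ le_n): wq => p wp qE; right; exists p.
    rewrite /twalk wp -(size_map c2) qE sq eqxx /=.
    by move: lq; rewrite -qE (last_map c2) => /orP [] /eqP [] // ->.
  by rewrite /ext2 /= -cats1 qE.
- rewrite /twalk /ext1 size_rcons size_map /= sp eqxx last_rcons eqxx andbT.
  rewrite -cats1 tpath_cat /= size_map sp eqxx (last_map c1) lp eqxx andbT.
  have le_n : 0 + size (map c1 p) <= n by rewrite size_map sp.
  by rewrite (introT (sum_tpath_inl a1 le_n)) ?eqxx ?orbT //; exists p.
rewrite /twalk /ext2 size_rcons size_map /= sp eqxx last_rcons eqxx andbT.
rewrite -cats1 tpath_cat /= size_map sp eqxx (last_map c2) lp eqxx ?orbT andbT.
have le_n : 0 + size (map c2 p) <= n by rewrite size_map sp.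
by rewrite (introT (sum_tpath_inr a2 le_n)) ?eqxx ?orbT //; exists p.
Qed.

Lemma represented_sum (H1 H2 : sgraph) : 0 < n ->
  represented H1 (twalk r1 a1 b1 n) -> represented H2 (twalk r2 a2 b2 n) ->
  represented (disjoint_union H1 H2) (twalk sum_step (c1 b1) (c1 b1) n.+2).
Proof.
move=> n_gt0 [f [f_inj fW f_adj]] [g [g_inj gW g_adj]].
have sf x : size (f x) = n.
  by have /and3P [/eqP] : twalk r1 a1 b1 n (f x) by apply/fW; exists x.
have sg y : size (g y) = n.
  by have /and3P [/eqP] : twalk r2 a2 b2 n (g y) by apply/gW; exists y.
have c1_inj : injective c1 by move=> ? ? [].
have c2_inj : injective c2 by move=> ? ? [].
have ext1_inj : injective ext1.
  by move=> p q /rcons_inj [] /(inj_map c1_inj).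
have ext2_inj : injective ext2.
  by move=> p q /rcons_inj [] /(inj_map c2_inj).
have hamming_ext12 x y : (hamming (ext1 (f x)) (ext2 (g y)) == 1) = false.
  have eq_s : size (a1 :: f x) = size (a2 :: g y) by rewrite /= sf sg.
  (* Once the common sink is removed, all [n.+1] positions differ in their tag, and [n > 0] makes
     that at least two. *)
  rewrite /ext1 /ext2 -!cats1 hamming_catr ?size_map //.
  by rewrite (hamming_inl_inr eq_s) /= sf eqSS (gtn_eqF n_gt0).
pose h (u : disjoint_union H1 H2) : seq (T1 + T2) :=
  match u with inl x => ext1 (f x) | inr y => ext2 (g y) end.
exists h; split=> [[x|x] [y|y] //=|q|[x|x] [y|y]] /=.
- by move/ext1_inj/f_inj ->.
- by move/ext2_inj/g_inj ->.
- apply: rwP; apply: (iffP (twalk_sum q)) => [[[p /fW [x <-] <-]|[p /gW [y <-] <-]]|[[x|y] <-]].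
  + by exists (inl x).
  + by exists (inr y).
  + by left; exists (f x) => //; apply/fW; exists x.
  + by right; exists (g y) => //; apply/gW; exists y.
- by rewrite f_adj /ext1 -!cats1 hamming_catr ?hamming_map ?size_map /= ?sf //
    /hamming /= eqxx.
- by rewrite hamming_ext12.
- by rewrite hammingC hamming_ext12.
- by rewrite g_adj /ext2 -!cats1 hamming_catr ?hamming_map ?size_map /= ?sg //
    /hamming /= eqxx.
Qed.

End Sum.

(** * Disjoint unions of shortest path graphs *)

Theorem theorem8 (H1 H2 : sgraph) :
  is_shortest_path_graph H1 -> is_shortest_path_graph H2 ->
  is_shortest_path_graph (disjoint_union H1 H2).
Proof.
move=> [G1 [a1 [b1 [ab1 iso1]]]] [G2 [a2 [b2 [ab2 iso2]]]].
have R1 := iso_represented iso1 (sp_graph_represented a1 b1).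
have R2 := iso_represented iso2 (sp_graph_represented a2 b2).
(* The successor makes [n] positive, which keeps walks of different families at Hamming distance at
   least two. *)
pose n := (maxn (dist a1 b1) (dist a2 b2)).+1.
have le1 : dist a1 b1 <= n by rewrite leqW // leq_maxl.
have le2 : dist a2 b2 <= n by rewrite leqW // leq_maxr.
have R := represented_sum (ltn0Sn _) (represented_padded le1 R1) (represented_padded le2 R2).
have [/eqP H0|/card_gt0P [x _]] := posnP #|disjoint_union H1 H2|.
  exact/empty_spg/eqP.
exact: represented_spg (ltn0Sn _) x R.
Qed.
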